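(* Let $k\ge 1$ and $0\le t\le k$ be integers and let $n\ge 1$. The total number of down-steps before the first up-step, summed over all $k_t$-Dyck paths of length $(k+1)n$, is \[ s_{n,t,0}=\frac{k}{n+1}\binom{(k+1)n}{n}-\frac{k-t}{n+1}\binom{(k+1)n+t}{n}. \]
   Context: A $k_t$-Dyck path (for a positive integer $k$ and integer $0\le t\le k$) is a lattice path consisting of up-steps $(1,k)$ and down-steps $(1,-1)$ that starts at $(0,0)$, stays weakly above the line $y=-t$, and ends on the line $y=0$; with $n$ up-steps it has length $(k+1)n$. $s_{n,t,0}$ denotes the total number, over all $k_t$-Dyck paths with $n$ up-steps, of down-steps occurring before the first up-step. *)

(* Defs.v *)
From mathcomp Require Import all_boot all_order all_algebra.
Set Implicit Arguments.
Unset Strict Implicit.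
Unset Printing Implicit Defensive.
Import Order.TTheory GRing.Theory Num.Theory.
Local Open Scope ring_scope.

(* A lattice path from (0,0) is the list of its steps: [true] is the up-step
   (1, k) and [false] is the down-step (1, -1). *)
Definition step_rise (k : nat) (b : bool) : int := if b then k%:Z else - 1.

Definition height (k : nat) (p : seq bool) : int := \sum_(b <- p) step_rise k b.

(* All ordinates are integers and steps are straight, so staying weakly above
   the line y = -t only has to be tested at the lattice points visited. *)
Definition is_dyck (k t : nat) (p : seq bool) : bool :=
  all (fun i => - t%:Z <= height k (take i p)) (iota 0 (size p).+1)
  && (height k p == 0).

Definition downs_before_first_up (p : seq bool) : nat :=
  count negb (take (index true p) p).

(* s_{n,t,0}; the number n of up-steps is enforced by the length (k+1)n, see
   [is_dyck_count_up]. *)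
Definition s0 (k n t : nat) : nat :=
  (\sum_(p : (k.+1 * n).-tuple bool | is_dyck k t p)
     downs_before_first_up p)%N.

Lemma heightE (k : nat) (p : seq bool) :
  height k p = (k * count id p)%N%:Z - (count negb p)%:Z.
Proof.
rewrite /height; elim: p => [|b p IHp]; first by rewrite big_nil muln0.
rewrite big_cons IHp; case: b => /=; rewrite ?add0n ?add1n.
  by rewrite mulnS PoszD addrA.
by rewrite -add1n PoszD opprD addrCA.
Qed.

Lemma is_dyck_count_up (k t n : nat) (p : seq bool) :
  is_dyck k t p -> (size p == k.+1 * n)%N = (count id p == n).
Proof.
case/andP=> _; rewrite heightE subr_eq0 => /eqP[kE].
have -> : size p = (k.+1 * count id p)%N.
  by rewrite mulSn kE -(count_predC id p).
by rewrite eqn_pmul2l.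
Qed.

(* Main.v *)
(** Measure levels from the line y = -t.  The down-steps before the first
    up-step are counted by the lengths [j] of the all-down prefixes, so [s0] is
    the sum over [1 <= x <= t], with [x = t - j + 1], of the number of paths that
    start at level [x - 1], never go below level 0 and end at level [t].  As
    [t <= k] and the level after the last up-step is at least [k], such a path
    extends uniquely by down-steps until it first hits level -1, so it is counted
    by the ballot number [x / n * 'C(x + (k + 1) n - 1, n - 1)].  The sum over [x]
    telescopes. *)

Require Import Defs.
From mathcomp Require Import all_boot all_order all_algebra.
From mathcomp Require Import zify ring.
Import GRing.Theory Num.Theory.
Local Open Scope ring_scope.

Lemma big_tuple_cons (T : finType) (L : nat) (F : seq T -> nat) :
  (\sum_(p : L.+1.-tuple T) F p =
   \sum_(x : T) \sum_(p : L.-tuple T) F (x :: p))%N.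
Proof.
rewrite pair_bigA /=.
rewrite (reindex (fun xp : T * L.-tuple T => cons_tuple xp.1 xp.2)) //=.
exists (fun p : L.+1.-tuple T => (thead p, behead_tuple p)) => [[x p]|p] _ /=.
  by rewrite theadE; congr (_, _); apply: val_inj.
by rewrite [RHS]tuple_eta; apply: val_inj.
Qed.

(** Recursion on the first step, carrying the current level [a] above y = -t, lets path counts be
    split by first step; the goal [t] is the level of y = 0. *)
Fixpoint stays_nonneg (k t a : nat) (p : seq bool) : bool :=
  match p with
  | [::] => a == t
  | true :: p' => stays_nonneg k t (a + k) p'
  | false :: p' => (0 < a)%N && stays_nonneg k t a.-1 p'
  end.

Lemma stays_nonnegE (k t a : nat) (p : seq bool) :
  stays_nonneg k t a p =
  all (fun i => - a%:Z <= height k (take i p)) (iota 0 (size p).+1)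
  && (height k p + a%:Z == t%:Z).
Proof.
have h0 : height k [::] = 0 by rewrite /height big_nil.
have hS b q : height k (b :: q) = step_rise k b + height k q.
  by rewrite /height big_cons.
have h_cons b q c : all (fun i => - c%:Z <= height k (take i (b :: q)))
    (iota 0 (size (b :: q)).+1) =
  all (fun i => - c%:Z <= step_rise k b + height k (take i q))
    (iota 0 (size q).+1).
  have -> : iota 0 (size (b :: q)).+1 = 0%N :: map S (iota 0 (size q).+1).
    by rewrite -(iotaDl 1 0).
  rewrite -[0%N :: _]cat1s all_cat all_seq1 take0 h0 oppr_le0 lez_nat leq0n.
  rewrite all_map.
  by apply: eq_all => i; rewrite /= hS.
elim: p a => [|[] p IHp] a.
- by rewrite /= h0 oppr_le0 /= add0r eqz_nat.
- rewrite h_cons hS /= IHp; congr (_ && _); last by apply/eqP/eqP; lia.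
  by apply: eq_all => i /=; lia.
rewrite h_cons hS /=; case: a => [|a]; first by rewrite /= take0 h0.
rewrite /= IHp; congr (_ && _); last by apply/eqP/eqP; lia.
by apply: eq_all => i /=; lia.
Qed.

Lemma is_dyckE (k t : nat) (p : seq bool) :
  is_dyck k t p = stays_nonneg k t t p.
Proof.
by rewrite stays_nonnegE /is_dyck; congr (_ && _); apply/eqP/eqP; lia.
Qed.

Local Open Scope nat_scope.

(* The number of paths with [n] up-steps from level [x] whose first visit to
   level 0 is at their end; [y.+1] is the level of the first up-step. *)
Fixpoint ballot (k n x : nat) : nat :=
  if n is n'.+1 then \sum_(y < x) ballot k n' (y.+1 + k) else 1.

(** First-step decomposition: an up-step leads to level [x.+1 + k], a down-step to level [x]. *)
Lemma ballotSS (k n x : nat) :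
  ballot k n.+1 x.+1 = ballot k n (x.+1 + k) + ballot k n.+1 x.
Proof. by rewrite /= big_ord_recr /= addnC. Qed.

Lemma ballot_closed (k n x : nat) :
  n.+1 * ballot k n.+1 x = x * 'C(x + k.+1 * n + k, n).
Proof.
elim: n x => [|n IHn] x; elim: x => [|x IHx].
- by rewrite /= big_ord0 muln0.
- by rewrite ballotSS mulnDr IHx /= !bin0; lia.
- by rewrite [ballot _ _ _]big_ord0 muln0.
rewrite ballotSS mulnDr IHx; set M := (x + _ + _).
have -> : (x.+1 + k.+1 * n.+1 + k) = M.+1 by rewrite /M; lia.
have {}IHn := IHn (x.+1 + k).
rewrite (_ : x.+1 + k + k.+1 * n + k = M) in IHn; last by rewrite /M; lia.
have mulC := mul_bin_left M n.
(* This form of [M - n] exposes the factor [x.+1 + k] of [IHn]; the subtraction is not truncated, as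
   the bound [le] below shows. *)
have MnE : M - n = n.+2 * (x.+1 + k) - n.+1 * x.+1 by rewrite /M; nia.
rewrite binS; apply/eqP; rewrite -(@eqn_pmul2l n.+1) //; apply/eqP.
rewrite {}MnE in mulC.
have : n.+1 * x.+1 <= n.+2 * (x.+1 + k) by nia.
move: mulC IHn; set B := ballot _ _ _; set c := 'C(_, _); set c1 := 'C(M, n).
move=> mulC IHn le.
have {mulC} : n.+1 * c + n.+1 * x.+1 * c1 = n.+2 * (x.+1 + k) * c1.
  by rewrite mulC -mulnDl subnK.
rewrite -[n.+2 * _ * _]mulnA -IHn => E.
have -> : n.+1 * (n.+2 * B + x * c) = n.+2 * (n.+1 * B) + n.+1 * x * c by ring.
by rewrite -E; ring.
Qed.

(** A step descends by at most one, so [L] steps cannot come down to [t]. *)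
Lemma count_stays_nonneg_too_high (k t L a : nat) : L + t < a ->
  \sum_(p : L.-tuple bool) stays_nonneg k t a p = 0.
Proof.
elim: L a => [|L IHL] a lt_a.
  rewrite big1 // => p _; rewrite tuple0 /=.
  by case: eqP => // ?; lia.
case: a lt_a => // a lt_a.
rewrite (big_tuple_cons _ _ (fun p => stays_nonneg k t a.+1 p : nat)).
by rewrite big_bool /= !IHL; lia.
Qed.

(** Both sides obey the same first-step recursion. The shift to [a.+1] turns never going below 0
    into first visiting 0 at the end of the extended path. *)
Lemma count_stays_nonneg (k t n m a : nat) : t <= k -> a + k * n = m + t ->
  \sum_(p : (n + m).-tuple bool) stays_nonneg k t a p = ballot k n a.+1.
Proof.
move=> le_tk; move: {2}(n + m) (erefl (n + m)) => L.
elim: L n m a => [|L IHL] n m a EL Ea; rewrite EL.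
  have [n0 m0] : n = 0 /\ m = 0 by lia.
  have -> : a = t by rewrite n0 m0 in Ea; lia.
  rewrite n0 (eq_bigr (fun=> 1)); first by rewrite sum1_card card_tuple.
  by move=> p _; rewrite tuple0 /= eqxx.
rewrite (big_tuple_cons _ _ (fun p => stays_nonneg k t a p : nat)) big_bool /=.
case: n EL Ea => [|n] EL Ea.
  case: m EL Ea => [|m] EL Ea; first by lia.
  have -> /= : a = (m + t).+1 by lia.
  rewrite count_stays_nonneg_too_high ?add0n; last by lia.
  have -> : L = 0 + m by lia.
  by apply: (IHL 0 m); lia.
rewrite ballotSS; congr (_ + _).
  have -> : L = n + m by lia.
  by apply: IHL; lia.
case: a Ea => [|a] Ea; first by rewrite big1 ?[RHS]big_ord0.
case: m EL Ea => [|m] EL Ea; first by nia.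
have -> : L = n.+1 + m by lia.
by apply: IHL; lia.
Qed.

(** Paths starting with an up-step contribute nothing. Deleting an initial down-step lowers the
    start from [a.+1] to [a] and the statistic by one, so the total grows by the number of paths
    from [a]. *)
Lemma sum_downs_stays_nonneg (k t n m a : nat) :
    t <= k -> 0 < n -> a + k * n = m + t ->
  \sum_(p : (n + m).-tuple bool | stays_nonneg k t a p)
    downs_before_first_up p = \sum_(x < a) ballot k n x.+1.
Proof.
move=> le_tk n_gt0; elim: a m => [|a IHa] m Ea; rewrite big_mkcond /=.
  rewrite big_ord0 big1 // => p _.
  by case: (tval p) => [|[] q] //=; case: ifP.
case: m Ea => [|m] Ea; first by nia.
rewrite addnS big_ord_recr /=.
rewrite (big_tuple_cons _ _
  (fun p => if stays_nonneg k t a.+1 p then downs_before_first_up p else 0)).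
rewrite big_bool /= big1 ?add0n => [|p _]; last by case: ifP.
rewrite -(@count_stays_nonneg k t n m a) -?(IHa m); try lia.
rewrite [in RHS]big_mkcond -big_split /=.
by apply: eq_bigr => p _; case: ifP; rewrite ?addn1.
Qed.

Lemma s0_ballot (k t n : nat) : t <= k -> 0 < n ->
  s0 k n t = \sum_(x < t) ballot k n x.+1.
Proof.
move=> le_tk n_gt0; rewrite /s0; under eq_bigl do rewrite is_dyckE.
by rewrite mulSn; apply: sum_downs_stays_nonneg => //; rewrite addnC.
Qed.

Local Open Scope ring_scope.

Lemma sum_ballot (k t n : nat) :
  (\sum_(x < t) ballot k n.+1 x.+1)%N%:R =
    k%:R / n.+2%:R * ('C(k.+1 * n.+1, n.+1))%:R
    - (k%:R - t%:R) / n.+2%:R * ('C(k.+1 * n.+1 + t, n.+1))%:R :> rat.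
Proof.
elim: t => [|t IHt]; first by rewrite big_ord0 addn0 subr0 subrr.
have -> : (\sum_(x < t.+1) ballot k n.+1 x.+1 =
    \sum_(x < t) ballot k n.+1 x.+1 + ballot k n.+1 t.+1)%N.
  exact: big_ord_recr.
rewrite natrD IHt {IHt}; set N := (k.+1 * n.+1)%N.
have EB := ballot_closed k n t.+1.
rewrite (_ : t.+1 + k.+1 * n + k = N + t)%N in EB; last by rewrite /N; lia.
have EC := mul_bin_left (N + t) n.
have le_n : (n <= N + t)%N by rewrite /N; nia.
have NE : N%:R = (k%:R + 1) * (n%:R + 1) :> rat by rewrite natrM -!natr1.
(* After Pascal's rule, [EB] and [EC] express the ballot number and ['C(N + t, n.+1)] through
   ['C(N + t, n)], leaving an identity of rational functions. *)
rewrite addnS (binS (N + t)).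
move: (ballot _ _ _) 'C(N, _) 'C(N + t, n.+1) 'C(N + t, n) EB EC => B d c c1.
move/(congr1 (GRing.natmul (1 : rat))) => EB.
move/(congr1 (GRing.natmul (1 : rat))); move: EB.
rewrite !natrM (natrB _ le_n) !natrD NE -!natr1 => EB EC.
have n1 : (n%:R + 1 != 0 :> rat) by rewrite natr1 pnatr_eq0.
have n2 : (n%:R + 1 + 1 != 0 :> rat) by rewrite !natr1 pnatr_eq0.
have -> : B%:R = (t%:R + 1) * c1%:R / (n%:R + 1) :> rat by rewrite -EB; field.
have -> : c%:R =
    ((k%:R + 1) * (n%:R + 1) + t%:R - n%:R) * c1%:R / (n%:R + 1) :> rat.
  by rewrite -EC; field.
by field; rewrite n1 n2.
Qed.

Theorem theorem5p5 (k t n : nat) (hk : (1 <= k)%N) (ht : (t <= k)%N)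
    (hn : (1 <= n)%N) :
  (s0 k n t)%:R =
    k%:R / n.+1%:R * ('C(k.+1 * n, n))%:R
    - (k%:R - t%:R) / n.+1%:R * ('C(k.+1 * n + t, n))%:R :> rat.
Proof. by rewrite s0_ballot //; case: n hn => // n _; apply: sum_ballot. Qed.
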